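(* Let $g\ge1$, let $\mathrm{al}_1,\mathrm{al}_2$ be the hyperelliptic al functions of the genus $g$ curve $X:\ y^2=\prod_{i=1}^{2g+1}(x-b_i)$ described in the context, let $\phi^{[a]}:=\log\mathrm{al}_a$ $(a=1,2)$, and write $h':=\partial_{u_g}h$. Let $t$ be an additional independent variable and set $$\psi(t,u):=e^{\mathrm i(b_2-b_1)t}\,\frac{\mathrm{al}_2(u)}{\mathrm{al}_1(u)},$$ where $\mathrm i$ is the imaginary unit. Then $$\mathrm i\,\partial_t\psi+\partial_{u_g}^2\psi+\left[2\,\frac{\phi^{[1]\prime}}{\mathrm i}\cdot\frac{\phi^{[1]\prime}-\phi^{[2]\prime}}{\mathrm i}\right]\psi=0 .$$
   Context: Curve: $b_1,\dots,b_{2g+1}\in\mathbb C$ are pairwise distinct, $f(x):=\prod_{i=1}^{2g+1}(x-b_i)$, and $X$ is the genus $g$ hyperelliptic curve $y^2=f(x)$ completed by one smooth point $\infty$ at infinity. Coordinates: for $((x_i,y_i))_{i=1,\dots,g}\in S^gX$ put $u=(u_1,\dots,u_g)\in\mathbb C^g$, $u_j=\sum_{i=1}^g\int_\infty^{(x_i,y_i)}\frac{x^{j-1}dx}{2y}$. All functions are regarded as functions of $u$ on an open set of $\mathbb C^g$ on which the $(x_i,y_i)$ are (finite) holomorphic functions of $u$, the $x_i$ are pairwise distinct, and no $x_i$ equals $b_1$ or $b_2$. With $F(x):=\prod_{i=1}^g(x-x_i)$ and $F'=dF/dx$, the derivatives in $u_g$ are $$\frac{\partial x_i}{\partial u_g}=\frac{2y_i}{F'(x_i)},\qquad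 \frac{\partial y_i}{\partial u_g}=\frac{f'(x_i)}{F'(x_i)} .$$ Al functions: for $a=1,2$, $\mathrm{al}_a$ is a holomorphic branch of the square root $\mathrm{al}_a(u)=\sqrt{\prod_{i=1}^g(x_i-b_a)}$, i.e. $\mathrm{al}_a^2=(-1)^gF(b_a)$. The derivative $\phi^{[a]\prime}=\partial_{u_g}\mathrm{al}_a/\mathrm{al}_a$ does not depend on the branch of the logarithm or square root. *)

(* Defs.v *)
From HB Require Import structures.
From mathcomp Require Import all_boot all_order all_algebra.
From mathcomp Require Import complex.
From mathcomp Require Import all_classical all_reals all_analysis.

Set Implicit Arguments.
Unset Strict Implicit.
Unset Printing Implicit Defensive.

Import Order.TTheory GRing.Theory Num.Theory.
Import numFieldNormedType.Exports.
Local Open Scope classical_set_scope.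
Local Open Scope ring_scope.
Local Open Scope complex_scope.

(* The type [R[i]] itself carries no topology; as an element of
   [numClosedFieldType] it gets the normed-module structure of MathComp-Analysis,
   so that ['D_v f] is the complex derivative in the direction v. *)
Definition Cplx (R : realType) : numClosedFieldType := R[i].

Definition cexp (R : realType) (z : Cplx R) : Cplx R :=
  (expR (complex.Re z))%:C * (cos (complex.Im z) +i* sin (complex.Im z)).

(* Riemann/Lebesgue integral over [a, b] of a complex function of a real
   variable, and derivative of such a function, both componentwise. *)
Definition cintegral (R : realType) (h : R -> Cplx R) (a b : R) : Cplx R :=
  Rintegral lebesgue_measure `[a, b] (fun s => complex.Re (h s)) +i*
  Rintegral lebesgue_measure `[a, b] (fun s => complex.Im (h s)).

Definition cderive (R : realType) (h : R -> Cplx R) (s : R) : Cplx R :=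
  'D_1 (fun r => complex.Re (h r)) s +i* 'D_1 (fun r => complex.Im (h r)) s.

Definition cC1_at (R : realType) (h : R -> Cplx R) (s : R) : Prop :=
  [/\ derivable (fun r => complex.Re (h r) : R) s 1,
      derivable (fun r => complex.Im (h r) : R) s 1 &
      {for s, continuous (cderive h)}].

(* Holomorphy on an open set of C^g.  As in most texts on several complex
   variables, the partial derivatives are taken continuous; by the theorems of
   Goursat and Osgood this is automatic for complex differentiable functions. *)
Definition holomorphic_on (R : realType) (g : nat)
    (U : set 'rV[Cplx R]_g) (h : 'rV[Cplx R]_g -> Cplx R) : Prop :=
  forall u, U u -> differentiable h u /\
    forall k : 'I_g, {for u, continuous (fun w => 'D_(delta_mx 0 k) h w)}.

(* The direction of the last coordinate u_g. *)
Definition e_last (R : realType) (g : nat) : 'rV[Cplx R]_g :=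
  \row_(j < g) (j.+1 == g)%:R.

Definition curve_poly (R : realType) (b : seq (Cplx R)) : {poly Cplx R} :=
  \prod_(c <- b) ('X - c%:P).

Definition on_curve (R : realType) (f : {poly Cplx R})
    (p : Cplx R * Cplx R) : Prop :=
  p.2 ^+ 2 = f.[p.1].

(* The value of dx/(2y) on the tangent vector (v, w) of y^2 = f(x) at p.  At the
   branch points, where y = 0, the relation 2y dy = f'(x) dx gives
   dx/(2y) = dy/f'(x), and f'(x) != 0 because f has simple roots. *)
Definition dx_over_2y (R : realType) (f : {poly Cplx R})
    (p : Cplx R * Cplx R) (v w : Cplx R) : Cplx R :=
  if p.2 == 0 then w / (f^`()).[p.1] else v / (2 * p.2).

(* The integral of x^j dx/(2y) along the restriction to [a, b] of the path gam;
   j is counted from 0, so the form belonging to u_j has exponent j-1 in the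
   usual one-based numbering. *)
Definition abelian_integral (R : realType) (f : {poly Cplx R}) (j : nat)
    (gam : R -> Cplx R * Cplx R) (a b : R) : Cplx R :=
  cintegral (fun s => (gam s).1 ^+ j *
    dx_over_2y f (gam s) (cderive (fun r => (gam r).1) s)
                         (cderive (fun r => (gam r).2) s)) a b.

(* gam(0+) = infinity, gam(1) = p, and gam is C^1 on ]0, 1] in the affine part of
   the curve: y^2 = f(x) has odd degree, hence a single point over x = oo. *)
Definition path_from_infty (R : realType) (f : {poly Cplx R})
    (p : Cplx R * Cplx R) (gam : R -> Cplx R * Cplx R) : Prop :=
  [/\ forall s : R, 0 < s <= 1 ->
        [/\ on_curve f (gam s), cC1_at (fun r => (gam r).1) s &
            cC1_at (fun r => (gam r).2) s],
      forall M : R, \forall s \near 0^'+, (M%:C : Cplx R) < `|(gam s).1| &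
      gam 1 = p].

(* The integral of x^j dx/(2y) from infinity, along gam, is v. *)
Definition integral_from_infty (R : realType) (f : {poly Cplx R}) (j : nat)
    (gam : R -> Cplx R * Cplx R) (v : Cplx R) : Prop :=
  abelian_integral f j gam e 1 @[e --> 0^'+] --> v.

(* The point of parameter s on the segment from u0 to u1. *)
Definition segment_pt (R : realType) (g : nat) (u0 u1 : 'rV[Cplx R]_g) (s : R) :
    'rV[Cplx R]_g :=
  u0 + (s%:C : Cplx R) *: (u1 - u0).

(* u_j = \sum_i \int_oo^(x_i, y_i) x^(j-1) dx/(2y), as functions of u in U.
   The integrals depend on the homotopy classes of the paths.  The paths ending at
   the points over u0 are arbitrary, but the same for all j; for u1 near u0 (more
   generally, if the segment [u0, u1] lies in U), each of them is continued by the
   arc described by (x_i, y_i) when u runs along [u0, u1].  Thus the integrals are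
   locally continuous branches. *)
Definition abel_coordinates (R : realType) (g : nat) (f : {poly Cplx R})
    (U : set 'rV[Cplx R]_g) (x y : 'I_g -> 'rV[Cplx R]_g -> Cplx R) : Prop :=
  forall u0, U u0 ->
  exists (gam : 'I_g -> R -> Cplx R * Cplx R) (c : 'I_g -> 'I_g -> Cplx R),
    [/\ forall i, path_from_infty f (x i u0, y i u0) (gam i),
        forall i j : 'I_g, integral_from_infty f j (gam i) (c i j) &
        forall u1, (forall s : R, 0 <= s <= 1 -> U (segment_pt u0 u1 s)) ->
        forall j : 'I_g,
          u1 0 j = \sum_(i < g)
            (c i j + abelian_integral f j
              (fun s => (x i (segment_pt u0 u1 s), y i (segment_pt u0 u1 s)))
              0 1)].

(* A holomorphic branch on U of the square root of \prod_i (x_i - a). *)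
Definition is_al (R : realType) (g : nat) (U : set 'rV[Cplx R]_g)
    (x : 'I_g -> 'rV[Cplx R]_g -> Cplx R) (a : Cplx R)
    (al : 'rV[Cplx R]_g -> Cplx R) : Prop :=
  holomorphic_on U al /\
  forall u, U u -> al u ^+ 2 = \prod_(i < g) (x i u - a).

(* d/du_g of log al; it does not depend on the branch of the logarithm. *)
Definition dphi (R : realType) (g : nat) (al : 'rV[Cplx R]_g -> Cplx R)
    (u : 'rV[Cplx R]_g) : Cplx R :=
  'D_(e_last R g) al u / al u.

Definition psi (R : realType) (g : nat) (b1 b2 : Cplx R)
    (al1 al2 : 'rV[Cplx R]_g -> Cplx R) (t : Cplx R) (u : 'rV[Cplx R]_g) :
    Cplx R :=
  cexp ('i * (b2 - b1) * t) * (al2 u / al1 u).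

(* Main.v *)
Require Import Defs.
From HB Require Import structures.
From mathcomp Require Import all_boot all_order all_algebra.
From mathcomp Require Import separable complex.
From mathcomp Require Import all_classical all_reals all_analysis.
From mathcomp Require Import ring lra.
Set Implicit Arguments.
Unset Strict Implicit.
Unset Printing Implicit Defensive.
Import Order.TTheory GRing.Theory Num.Theory.
Import numFieldNormedType.Exports.
Local Open Scope classical_set_scope.
Local Open Scope ring_scope.

(** Write D for the derivative in u_g and ' for d/dx.  Differentiating the Abel
    coordinates along u_g and inverting a Vandermonde system gives the flow
    D x_i = 2 y_i / F'(x_i), D y_i = f'(x_i) / F'(x_i).  Let Q be the polynomial of
    degree < g with Q(x_i) = y_i.  Then D F = - 2 Q, and if H is the monic
    polynomial with f - Q^2 = F H, then H and D Q agree at the x_i, so that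
    H - D Q = (x + c) F with c independent of x.  At a branch point b_a this yields
    D^2 al_a = (b_a + c) al_a with the same c for all a, and the equation for psi is
    the quotient rule applied twice to al_2 / al_1. *)

(** * Interpolation at the points of a divisor *)

Section Interpolation.
Variables (K : fieldType) (g : nat) (x : 'I_g -> K).

Definition nodal : {poly K} := \prod_i ('X - (x i)%:P).

(** The nodal polynomial with one factor removed. Its value at [x i] is F'(x_i), the denominator in
    the flow. *)
Definition conodal (i : 'I_g) : {poly K} := \prod_(j | j != i) ('X - (x j)%:P).

(** Lagrange's formula. When the points (x_i, y_i) lie on the curve, it forms with [nodal] the
    Mumford representation of their divisor. *)
Definition interpolant (y : 'I_g -> K) : {poly K} :=
  \sum_i ((conodal i).[x i]^-1 * y i) *: conodal i.

Hypothesis x_inj : injective x.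

Lemma nodalE i : nodal = ('X - (x i)%:P) * conodal i.
Proof. by rewrite /nodal (bigD1 i). Qed.

Lemma size_nodal : size nodal = g.+1.
Proof. by rewrite size_prod_XsubC -[index_enum _]enumT size_enum_ord. Qed.

Lemma nodal_monic : nodal \is monic.
Proof. exact: monic_prod_XsubC. Qed.

Lemma conodal_monic i : conodal i \is monic.
Proof. exact: monic_prod_XsubC. Qed.

Lemma size_conodal i : size (conodal i) = g.
Proof.
have := size_nodal; rewrite (nodalE i) size_monicM ?monicXsubC //.
  by rewrite size_XsubC; case.
by rewrite monic_neq0 ?conodal_monic.
Qed.

Lemma conodal_neq0 i : (conodal i).[x i] != 0.
Proof.
rewrite horner_prod; apply/prodf_neq0 => j ji.
by rewrite hornerXsubC subr_eq0 (inj_eq x_inj) eq_sym.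
Qed.

Lemma conodal_eq0 i j : j != i -> (conodal j).[x i] = 0.
Proof.
by move=> ji; rewrite horner_prod (bigD1 i) 1?eq_sym //= hornerXsubC subrr mul0r.
Qed.

Lemma root_nodal i : nodal.[x i] = 0.
Proof. by rewrite (nodalE i) hornerM hornerXsubC subrr mul0r. Qed.

Lemma deriv_nodal i : nodal^`().[x i] = (conodal i).[x i].
Proof.
by rewrite (nodalE i) derivM derivXsubC mul1r hornerD hornerM hornerXsubC subrr
  mul0r addr0.
Qed.

Lemma nodal_dvdp p : (forall i, p.[x i] = 0) -> nodal %| p.
Proof.
move=> p0.
have -> : nodal = \prod_(z <- codom x) ('X - z%:P) by rewrite big_image.
apply: uniq_roots_dvdp; last by rewrite uniq_rootsE map_inj_uniq ?enum_uniq.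
by apply/allP => _ /mapP[i _ ->]; apply/rootP.
Qed.

Lemma size_interpolant y : (size (interpolant y) <= g)%N.
Proof.
apply: (leq_trans (size_sum _ _ _)); apply/bigmax_leqP => i _.
by rewrite (leq_trans (size_scale_leq _ _)) ?size_conodal.
Qed.

Lemma horner_interpolant y i : (interpolant y).[x i] = y i.
Proof.
rewrite horner_sum (bigD1 i) //= big1 => [|j ji]; last first.
  by rewrite hornerZ (conodal_eq0 ji) mulr0.
by rewrite addr0 hornerZ mulrAC mulVf ?mul1r ?conodal_neq0.
Qed.

(** The difference has degree less than g and is divisible by [nodal], which has degree g. *)
Lemma interpolation_unique (p q : {poly K}) : (size p <= g)%N -> (size q <= g)%N ->
  (forall i, p.[x i] = q.[x i]) -> p = q.
Proof.
move=> sp sq pq; apply/eqP; rewrite -subr_eq0; apply/eqP.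
have [//|nz] := eqVneq (p - q) 0.
have /(dvdp_leq nz) : nodal %| p - q.
  by apply: nodal_dvdp => i; rewrite hornerD hornerN pq subrr.
rewrite size_nodal leqNgt ltnS => /negP; case.
by rewrite (leq_trans (size_polyD _ _)) // size_polyN geq_max sp sq.
Qed.

(* Only the node [x i] contributes to the left-hand side for [conodal i], whose
   leading coefficient is 1. *)
Lemma residue_weights (w : 'I_g -> K) :
  (forall j : 'I_g, \sum_i x i ^+ j * w i = (j.+1 == g)%:R) ->
  forall i, w i = (conodal i).[x i]^-1.
Proof.
move=> hw i; have g0 : (0 < g)%N := leq_ltn_trans (leq0n i) (ltn_ord i).
suff e : (conodal i).[x i] * w i = 1.
  by rewrite -[LHS]mul1r -(mulVf (conodal_neq0 i)) -mulrA e mulr1.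
transitivity (\sum_k (conodal i).[x k] * w k).
  rewrite [RHS](bigD1 i) //= big1 ?addr0 // => k ki.
  by rewrite conodal_eq0 1?eq_sym ?mul0r.
under eq_bigr => k _ do
  rewrite (@horner_coef_wide _ g) ?size_conodal // mulr_suml.
rewrite exchange_big /=.
under eq_bigr => j _.
  under eq_bigr => k _ do rewrite -mulrA.
  rewrite -mulr_sumr hw.
over.
(* The moments given by [hw] vanish except at j = g - 1, so only the top coefficient survives. *)
have g1 : (g.-1 < g)%N by rewrite prednK.
rewrite (bigD1 (Ordinal g1)) //= big1 => [|j].
  rewrite addr0 prednK // eqxx mulr1.
  by have /monicP := conodal_monic i; rewrite /lead_coef size_conodal.
rewrite -val_eqE /= => jg.
have /negbTE -> : j.+1 != g by apply: contraNneq jg => /(congr1 predn) /= ->.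
by rewrite mulr0.
Qed.

End Interpolation.

(* [f - Q ^ 2] is [F * H] with [F] nodal and [H] monic of degree [g + 1].  The
   flow equations say that [H] and the velocity [Qd] of [Q] agree at the nodes,
   so [H - Qd = ('X + c) * F]; now evaluate at a root of [f]. *)
Lemma mumford_velocity (K : fieldType) (g : nat) (x y : 'I_g -> K)
    (f Qd : {poly K}) (x_inj : injective x) (Q := interpolant x y) :
  (0 < g)%N -> f \is monic -> size f = (2 * g).+2 ->
  (forall i, y i ^+ 2 = f.[x i]) -> (size Qd <= g)%N ->
  (forall i, Qd.[x i] + Q^`().[x i] * (2 * y i / (conodal x i).[x i]) =
             f^`().[x i] / (conodal x i).[x i]) ->
  exists c, forall a, f.[a] = 0 ->
    - Q.[a] ^+ 2 - Qd.[a] * (nodal x).[a] = (a + c) * (nodal x).[a] ^+ 2.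
Proof.
move=> g0 fm sf yf sQd hQd.
have F0 : nodal x != 0 by rewrite monic_neq0 ?nodal_monic.
(* Q^2 has degree at most 2g - 2, so it leaves the leading term of f unchanged. *)
have sQ : (size (Q ^+ 2) < (2 * g).+2)%N.
  have sQ := size_interpolant x y; apply: leq_ltn_trans (size_polyMleq _ _) _.
  by rewrite ltnS ltnW // ltnS (leq_trans (leq_pred _)) // mul2n -addnn leq_add.
have [H hH] : exists H, f - Q ^+ 2 = H * nodal x.
  apply/dvdpP; apply: nodal_dvdp => // i.
  by rewrite hornerD hornerN horner_exp horner_interpolant // yf subrr.
have mFH : H * nodal x \is monic.
  by rewrite -hH monicE lead_coefDl ?size_polyN ?sf // -monicE.
have mH : H \is monic by move: mFH; rewrite monicMr ?nodal_monic.
have sH : size H = g.+2.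
  have : size (H * nodal x) = (2 * g).+2.
    by rewrite -hH size_polyDl ?size_polyN sf.
  rewrite size_Mmonic ?monic_neq0 ?nodal_monic // size_nodal addnS /= mulSn mul1n.
  by rewrite -!addSn => /addIn.
have sQdH : (size Qd < size H)%N by rewrite sH ltnS (leq_trans sQd).
have [G hG] : exists G, H - Qd = G * nodal x.
  apply/dvdpP; apply: nodal_dvdp => // i; set k := (conodal x i).[x i].
  have k0 : k != 0 by exact: conodal_neq0.
  (* Differentiating f - Q^2 = H F at x_i, where F vanishes, gives f'(x_i) - 2 y_i Q'(x_i) = H(x_i)
     F'(x_i); [hQd] gives the same value for [Qd]. *)
  have e := congr1 (fun p => p^`().[x i]) hH.
  move: e; rewrite /= !poly.derivE /= !hornerE root_nodal deriv_nodal -/k mulr0 add0r.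
  rewrite horner_interpolant // => e.
  rewrite -[H.[_]](mulfK k0) -e; have := hQd i; rewrite -/k => /eqP.
  rewrite eq_sym -subr_eq => /eqP <-; apply/eqP; rewrite subr_eq0; apply/eqP.
  by rewrite /k in k0 *; field.
have mFG : G * nodal x \is monic.
  by rewrite -hG monicE lead_coefDl ?size_polyN // -monicE.
have mG : G \is monic by move: mFG; rewrite monicMr ?nodal_monic.
have sG : size G = 2.
  have : size (G * nodal x) = g.+2 by rewrite -hG size_polyDl ?size_polyN.
  rewrite size_Mmonic ?monic_neq0 ?nodal_monic // size_nodal addnS /=.
  by rewrite -[g.+2]add2n => /addIn.
(* [G] is monic of degree 1, so its constant coefficient is the required c. *)
exists G`_0 => a fa.
have Ga : G.[a] = a + G`_0.
  rewrite horner_coef sG big_ord_recl big_ord1 /= mulr1 addrC expr1.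
  by move/monicP: mG; rewrite /lead_coef sG /= /bump /= => ->; rewrite mul1r.
(* At a root of f the factorizations read -Q^2 = H F and H - Qd = (a + c) F; multiplying the second
   by F gives the claim. *)
have := congr1 (horner^~ a) hH; have := congr1 (horner^~ a) hG.
rewrite /= !hornerE fa Ga sub0r => e1 e2.
by rewrite e2 -mulrBl e1.
Qed.

(** * The flow and the second derivative of al *)

Section PolynomialFamily.
Variables (K : numFieldType) (V : normedModType K).
Implicit Types (p q : V -> {poly K}) (u v : V).

Definition derivable_coefs p u v : Prop :=
  forall k, derivable (fun w => (p w)`_k) u v.

(** The derivative of the family, taken coefficientwise. Truncation at [n] makes it a polynomial and
    loses nothing when every [p w] has size at most [n]. *)
Definition velocity n p u v : {poly K} :=
  \poly_(k < n) 'D_v (fun w => (p w)`_k) u.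

Lemma derivable_coefs_cst (c : {poly K}) u v : derivable_coefs (fun=> c) u v.
Proof. by move=> k; exact: derivable_cst. Qed.

Lemma derivable_coefsM p q u v : derivable_coefs p u v ->
  derivable_coefs q u v -> derivable_coefs (fun w => p w * q w) u v.
Proof.
move=> dp dq k.
have -> : (fun w => (p w * q w)`_k) =
    \sum_(j < k.+1) ((fun w => (p w)`_j) * (fun w => (q w)`_(k - j))).
  by apply/funext => w; rewrite coefM fct_sumE.
by apply: derivable_sum => j; exact: derivableM.
Qed.

Lemma derivable_coefsD p q u v : derivable_coefs p u v ->
  derivable_coefs q u v -> derivable_coefs (fun w => p w + q w) u v.
Proof.
move=> dp dq k.
under [X in derivable X _ _]funext => w do rewrite coefD.
by apply: derivableD; [exact: dp|exact: dq].
Qed.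

Lemma derivable_coefs_sum (I : Type) (r : seq I) (P : pred I)
    (p : I -> V -> {poly K}) u v :
  (forall i, P i -> derivable_coefs (p i) u v) ->
  derivable_coefs (fun w => \sum_(i <- r | P i) p i w) u v.
Proof.
move=> dp; elim: r => [|i r IH].
  under [X in derivable_coefs X _ _]funext => w do rewrite big_nil.
  exact: derivable_coefs_cst.
under [X in derivable_coefs X _ _]funext => w do rewrite big_cons.
by case Pi: (P i); first by apply: derivable_coefsD => //; exact: dp.
Qed.

Lemma derivable_coefs_prod (I : Type) (r : seq I) (P : pred I)
    (p : I -> V -> {poly K}) u v :
  (forall i, P i -> derivable_coefs (p i) u v) ->
  derivable_coefs (fun w => \prod_(i <- r | P i) p i w) u v.
Proof.
move=> dp; elim: r => [|i r IH].
  under [X in derivable_coefs X _ _]funext => w do rewrite big_nil.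
  exact: derivable_coefs_cst.
under [X in derivable_coefs X _ _]funext => w do rewrite big_cons.
by case Pi: (P i); first by apply: derivable_coefsM => //; exact: dp.
Qed.

Lemma derivable_coefsZ (c : V -> K) p u v : derivable c u v ->
  derivable_coefs p u v -> derivable_coefs (fun w => c w *: p w) u v.
Proof.
move=> dc dp k.
under [X in derivable X _ _]funext => w do rewrite coefZ.
exact: derivableM.
Qed.

Lemma derivable_coefs_XsubC (c : V -> K) u v : derivable c u v ->
  derivable_coefs (fun w => 'X - (c w)%:P) u v.
Proof.
move=> dc k.
under [X in derivable X _ _]funext => w do rewrite coefB coefC.
apply: derivableB; first exact: derivable_cst.
by case: (k == 0%N); [exact: dc|exact: derivable_cst].
Qed.

(** Product rule on each monomial. The size bound is uniform in w, so the sum over monomials has a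
    fixed range and can be differentiated termwise. *)
Lemma is_derive_horner_family n p (z : V -> K) u v dz :
  derivable_coefs p u v -> (forall w, (size (p w) <= n)%N) ->
  is_derive u v z dz ->
  is_derive u v (fun w => (p w).[z w])
    ((velocity n p u v).[z u] + (p u)^`().[z u] * dz).
Proof.
move=> dp sp hz.
have -> : (fun w => (p w).[z w]) =
    \sum_(k < n) ((fun w => (p w)`_k) * z ^+ k).
  apply/funext => w; rewrite (horner_coef_wide _ (sp w)) fct_sumE.
  by apply: eq_bigr => k _; rewrite -[RHS]/(_ * (z ^+ k) w) exprfctE.
have dk (k : 'I_n) : is_derive u v ((fun w => (p w)`_k) * z ^+ k)
    ((p u)`_k *: ((k%:R * z u ^+ k.-1) *: dz) +
     (z ^+ k) u *: 'D_v (fun w => (p w)`_k) u).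
  apply: is_deriveM.
  by apply: derivableP; exact: dp.
apply: (is_derive_eq (is_derive_sum dk)).
rewrite /velocity poly_def.
have {2}-> : p u = \sum_(k < n) (p u)`_k *: 'X^k.
  by rewrite -poly_def; apply/polyP => k; rewrite coef_poly; case: ltnP => // kn;
    rewrite nth_default // (leq_trans (sp u)).
rewrite raddf_sum /= !horner_sum mulr_suml -big_split /=.
apply: eq_bigr => k _; rewrite derivZ derivXn !hornerE hornerMn hornerXn.
rewrite /GRing.scale /= -mulr_natl addrC.
by rewrite !exprfctE; ring.
Qed.

Lemma derivable_horner_family n p (z : V -> K) u v :
  derivable_coefs p u v -> (forall w, (size (p w) <= n)%N) ->
  derivable z u v -> derivable (fun w => (p w).[z w]) u v.
Proof.
by move=> dp sp /derivableP dz; have [] := is_derive_horner_family dp sp dz.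
Qed.

End PolynomialFamily.

(** * Product and quotient rules for scalar functions *)

Section DirectionalDerivative.
Variables (K : numFieldType) (V : normedModType K).
Implicit Types (f h : V -> K) (u v : V).

Lemma is_derive_mul f h u v df dh : is_derive u v f df -> is_derive u v h dh ->
  is_derive u v (fun w => f w * h w) (f u * dh + df * h u).
Proof.
by move=> hf hh; apply: is_derive_eq; rewrite /GRing.scale /= [h u * _]mulrC.
Qed.

Lemma is_derive_div f h u v df dh : h u != 0 ->
  is_derive u v f df -> is_derive u v h dh ->
  is_derive u v (fun w => f w / h w) ((df * h u - f u * dh) / h u ^+ 2).
Proof.
move=> h0 hf [dh1 dh2].
have hV : is_derive u v (fun w => (h w)^-1) (- (h u) ^- 2 *: dh).
  by split; [exact: derivableV|rewrite deriveV // dh2].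
apply: is_derive_eq (is_derive_mul hf hV) _.
by rewrite /GRing.scale /=; field.
Qed.

End DirectionalDerivative.

(** * The flow of the divisor and of its Mumford polynomials *)

Section Flow.
Variables (K : numFieldType) (V : normedModType K) (g : nat) (v : V).
Variables (U : set V) (f : {poly K}) (x y : 'I_g -> V -> K).
Hypotheses (g0 : (0 < g)%N) (hU : open U).
Hypotheses (f_monic : f \is monic) (size_f : size f = (2 * g).+2).
Hypothesis x_inj : forall w, U w -> injective (fun i => x i w).
Hypothesis on_f : forall w, U w -> forall i, y i w ^+ 2 = f.[x i w].
Let F w := nodal (fun i => x i w).
Let L w := conodal (fun i => x i w).
Let Q w := interpolant (fun i => x i w) (fun i => y i w).
Hypothesis x_flow : forall w, U w -> forall i,
  is_derive w v (x i) (2 * y i w / (L w i).[x i w]).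
Hypothesis y_flow : forall w, U w -> forall i,
  is_derive w v (y i) (f^`().[x i w] / (L w i).[x i w]).

Lemma derivable_coefs_conodal w i : U w -> derivable_coefs (L^~ i) w v.
Proof.
move=> Uw; apply: derivable_coefs_prod => j _; apply: derivable_coefs_XsubC.
by have [] := x_flow Uw j.
Qed.

Lemma derivable_coefs_nodal w : U w -> derivable_coefs F w v.
Proof.
move=> Uw; apply: derivable_coefs_prod => j _; apply: derivable_coefs_XsubC.
by have [] := x_flow Uw j.
Qed.

(** The coefficients are rational in the x_i and y_i, with denominators F'(x_i) that do not vanish
    on [U]. *)
Lemma derivable_coefs_interpolant w : U w -> derivable_coefs Q w v.
Proof.
move=> Uw; apply: derivable_coefs_sum => i _.
have dx : derivable (x i) w v by have [] := x_flow Uw i.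
have dy : derivable (y i) w v by have [] := y_flow Uw i.
apply: derivable_coefsZ; last exact: derivable_coefs_conodal.
have dL : derivable (fun z => (L z i).[x i z]) w v.
  apply: (derivable_horner_family (n := g) (p := fun z => L z i)
    (z := x i)) => //.
    exact: derivable_coefs_conodal.
  by move=> z; rewrite size_conodal.
have dV : derivable (fun z => (L z i).[x i z]^-1) w v.
  by apply: derivableV dL; exact: conodal_neq0 (x_inj Uw) i.
exact: derivableM dV dy.
Qed.

(** Differentiating F(x_i) = 0 along the flow gives (D F)(x_i) = - F'(x_i) D x_i = - 2 y_i. Since F
    is monic of degree g, D F has degree less than g and is determined by these values. *)
Lemma velocity_nodal w : U w -> velocity g.+1 F w v = - 2%:P * Q w.
Proof.
move=> Uw; have sF z : (size (F z) <= g.+1)%N by rewrite size_nodal.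
have dF := derivable_coefs_nodal Uw.
apply: (interpolation_unique (x_inj Uw)).
- apply/leq_sizeP => k gk; rewrite coef_poly; case: ltnP => // kg.
  have -> : k = g by apply/eqP; rewrite eqn_leq gk andbT.
  rewrite [X in derive X](_ : _ = cst 1) ?derive_cst //.
  by apply/funext => z; have /monicP := nodal_monic (x^~ z);
    rewrite /lead_coef size_nodal.
- apply: leq_trans (size_polyMleq _ _) _.
  rewrite -polyCN size_polyC oppr_eq0 pnatr_eq0 /=.
  exact: size_interpolant.
move=> i; have := is_derive_horner_family dF sF (x_flow Uw i).
have -> : (fun z => (F z).[x i z]) = cst 0.
  by apply/funext => z; exact: (root_nodal (x^~ z)).
move=> [_]; rewrite derive_cst deriv_nodal mulrC divfK ?(conodal_neq0 (x_inj Uw)) //.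
move=> /esym/eqP; rewrite addr_eq0 => /eqP ->.
by rewrite -polyCN hornerCM horner_interpolant ?mulNr //; exact: x_inj.
Qed.

Lemma is_derive_nodal w a : U w ->
  is_derive w v (fun z => (F z).[a]) (- 2 * (Q w).[a]).
Proof.
move=> Uw; have sF z : (size (F z) <= g.+1)%N by rewrite size_nodal.
apply: is_derive_eq.
  exact: (is_derive_horner_family (derivable_coefs_nodal Uw) sF (is_derive_cst a w v)).
by rewrite mulr0 addr0 velocity_nodal // -polyCN hornerCM.
Qed.

Section SquareRoot.
Variables (a : K) (al : V -> K).
Hypothesis x_neq_a : forall w, U w -> forall i, x i w != a.
Hypothesis al_derivable : forall w, U w -> derivable al w v.
Hypothesis al_sqr : forall w, U w -> al w ^+ 2 = \prod_i (x i w - a).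

Lemma nodal_al w : U w -> al w ^+ 2 = (-1) ^+ g * (F w).[a].
Proof.
move=> Uw; rewrite al_sqr // /F /nodal horner_prod.
under [in RHS]eq_bigr => i _ do rewrite hornerXsubC -opprB.
by rewrite prodrN card_ord mulrA -exprD addnn -mul2n exprM sqrrN !expr1n mul1r.
Qed.

Lemma nodal_a_neq0 w : U w -> (F w).[a] != 0.
Proof.
move=> Uw; rewrite horner_prod; apply/prodf_neq0 => i _.
by rewrite hornerXsubC subr_eq0 eq_sym x_neq_a.
Qed.

Lemma al_neq0 w : U w -> al w != 0.
Proof.
move=> Uw; rewrite -sqrf_eq0 nodal_al // mulf_neq0 ?nodal_a_neq0 //.
by rewrite signr_eq0.
Qed.

(** Differentiating al^2 = (-1)^g F(a) gives 2 al D al = (-1)^g (- 2 Q(a)); the sign is then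
    eliminated by the same relation. *)
Lemma derive_al w : U w -> 'D_v al w = - (Q w).[a] * al w / (F w).[a].
Proof.
move=> Uw; have da := derivableP (al_derivable Uw).
have e : is_derive w v (fun z => al z * al z) ((-1) ^+ g * (- 2 * (Q w).[a])).
  (* The relation between al^2 and F(a) holds on the open set [U], hence near w, which suffices for
     derivatives. *)
  apply: (@near_eq_is_derive _ _ _ (fun z => (-1) ^+ g * (F z).[a])).
    by near=> z; rewrite -nodal_al //; near: z; exact: open_nbhs_nbhs.
  apply: is_derive_eq (is_derive_mul (is_derive_cst _ _ _) (is_derive_nodal _ Uw)) _.
  by rewrite mul0r addr0.
have [_ e1] := e; have [_ e2] := is_derive_mul da da.
have h := nodal_al Uw; have F0 := nodal_a_neq0 Uw; have a0 := al_neq0 Uw.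
have two : 2 != 0 :> K by rewrite pnatr_eq0.
apply: (mulfI (mulf_neq0 two a0)).
have -> : 2 * al w * 'D_v al w = (-1) ^+ g * (- 2 * (Q w).[a]).
  by rewrite -e1 e2; ring.
have -> : 2 * al w * (- (Q w).[a] * al w / (F w).[a]) =
  - 2 * (Q w).[a] * (al w ^+ 2) / (F w).[a] by field.
by rewrite h; field.
Unshelve. all: by end_near. Qed.

End SquareRoot.

(** The quotient rule applied to D al = - Q(a) al / F(a) gives D^2 al = (- Q(a)^2 - (D Q)(a) F(a)) /
    F(a)^2 al, and [mumford_velocity] evaluates the fraction. Its constant is chosen before the
    branch point. *)
Lemma al_second_derivative w : U w -> exists c, forall a (al : V -> K), f.[a] = 0 ->
  (forall z, U z -> forall i, x i z != a) ->
  (forall z, U z -> derivable al z v) ->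
  (forall z, U z -> al z ^+ 2 = \prod_i (x i z - a)) ->
  is_derive w v ('D_v al) ((a + c) * al w).
Proof.
move=> Uw; have sQ z : (size (Q z) <= g)%N by exact: size_interpolant.
have dQ := derivable_coefs_interpolant Uw.
have [|i|c hc] := mumford_velocity (Qd := velocity g Q w v) (x_inj Uw) g0 f_monic
  size_f (on_f Uw).
- exact: size_poly.
(* The condition on [Qd] is the derivative of Q(x_i) = y_i along the flow. *)
- have [_ e1] := is_derive_horner_family dQ sQ (x_flow Uw i); rewrite -[LHS]e1.
  have [_ e2] := y_flow Uw i; rewrite -[RHS]e2; apply: near_eq_derive.
  near=> z; rewrite horner_interpolant //; apply: x_inj; near: z.
  exact: open_nbhs_nbhs.
exists c => a al fa xa dal al2.
have F0 := nodal_a_neq0 xa Uw; have a0 := al_neq0 xa al2 Uw.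
have dQa : is_derive w v (fun z => (Q z).[a]) (velocity g Q w v).[a].
  apply: is_derive_eq (is_derive_horner_family dQ sQ (is_derive_cst a w v)) _.
  by rewrite mulr0 addr0.
have dN : is_derive w v (fun z => - (Q z).[a]) (- (velocity g Q w v).[a]).
  exact: is_deriveN dQa.
have dNal := is_derive_mul dN (derivableP (dal _ Uw)).
have dq := is_derive_div (h := fun z => (F z).[a]) F0 dNal (is_derive_nodal a Uw).
apply: (@near_eq_is_derive _ _ _ (fun z => - (Q z).[a] * al z / (F z).[a])).
  near=> z; rewrite (derive_al xa dal al2) //; near: z.
  exact: open_nbhs_nbhs.
apply: is_derive_eq dq _; rewrite (derive_al xa dal al2 Uw).
transitivity ((- (Q w).[a] ^+ 2 - (velocity g Q w v).[a] * (F w).[a]) /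
  (F w).[a] ^+ 2 * al w).
  by field.
by rewrite hc //; field.
Unshelve. all: by end_near. Qed.

End Flow.

(** * Complex functions along real lines, and the exponential *)

Section ComplexCalculus.
Local Open Scope complex_scope.
Variable R : realType.
Local Notation C := (Cplx R).

(** The projections and the embedding are typed with [Cplx R], so that they are maps from or to the
    normed field. *)
Definition cRe (z : C) : R := complex.Re z.
Definition cIm (z : C) : R := complex.Im z.
Definition rC (r : R) : C := r%:C.

HB.instance Definition _ := GRing.RMorphism.copy rC (real_complex R).

Lemma norm_rC r : `|rC r| = rC `|r|.
Proof. by rewrite /rC normc_def /= expr0n /= addr0 sqrtr_sqr. Qed.

Lemma rC_gt0 r : (0 < rC r) = (0 < r).
Proof. exact: (@ltcR _ 0 r). Qed.

(** Radii in [Cplx R] are complex numbers; this turns a positive one into a real radius. *)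
Lemma gt0_rC (e : C) : 0 < e -> e = rC (cRe e) /\ 0 < cRe e.
Proof.
move=> e0; have ee : e = rC (cRe e) by rewrite /rC /cRe RRe_real // gtr0_real.
by split => //; rewrite -rC_gt0 -ee.
Qed.

Lemma cReM r z : cRe (rC r * z) = r * cRe z.
Proof. by case: z => a b; rewrite /cRe /= mul0r subr0. Qed.

Lemma cImM r z : cIm (rC r * z) = r * cIm z.
Proof. by case: z => a b; rewrite /cIm /= mul0r addr0. Qed.

Lemma norm_cRe z : rC `|cRe z| <= `|z|.
Proof. exact: normc_ge_Re. Qed.

Lemma norm_cIm z : rC `|cIm z| <= `|z|.
Proof.
case: z => a b; rewrite /rC /cIm normc_def /= lecR -sqrtr_sqr ler_wsqrtr //.
by rewrite lerDr sqr_ge0.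
Qed.

Lemma continuous_cRe : continuous cRe.
Proof.
move=> z; apply/(cvgrPdist_lt (FF := nbhs_filter (z : C))) => e e0.
exists (rC e); first by rewrite /= rC_gt0.
move=> w /= zw; rewrite -ltcR; apply: le_lt_trans zw.
by have := norm_cRe (z - w); rewrite /cRe raddfB.
Qed.

Lemma continuous_cIm : continuous cIm.
Proof.
move=> z; apply/(cvgrPdist_lt (FF := nbhs_filter (z : C))) => e e0.
exists (rC e); first by rewrite /= rC_gt0.
move=> w /= zw; rewrite -ltcR; apply: le_lt_trans zw.
by have := norm_cIm (z - w); rewrite /cIm raddfB.
Qed.

Lemma continuous_rC : continuous rC.
Proof.
move=> r; apply/cvgrPdist_lt => e /gt0_rC[-> e0]; exists (cRe e) => // s /= rs.
by rewrite -rmorphB norm_rC ltcR.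
Qed.

Lemma dnbhs_rC : rC r @[r --> 0^'] --> 0^'.
Proof.
move=> A [e /= /gt0_rC[-> e0] hA]; exists (cRe e) => // r /= re r0.
apply: hA; last by rewrite eq_complex /= eqxx andbT.
by move: re; rewrite /= !sub0r !normrN norm_rC ltcR.
Qed.

(** * Complex derivatives along real lines *)

Section RealLine.
Variables (V : normedModType C) (f : V -> C) (u v : V).

(** Nonzero real increments tending to 0 are among the complex ones, so the complex difference
    quotient may be restricted to them. *)
Lemma cvg_real_quotient s : derivable f (u + rC s *: v) v ->
  (rC k)^-1 * (f (u + rC (k + s) *: v) - f (u + rC s *: v)) @[k --> 0^'] -->
  'D_v f (u + rC s *: v).
Proof.
move=> df; have := cvg_comp _ _ dnbhs_rC df; apply: cvg_trans; apply: near_eq_cvg.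
near=> k; rewrite /=.
by have -> : u + rC (k + s) *: v = rC k *: v + (u + rC s *: v)
  by rewrite rmorphD scalerDl addrCA.
Unshelve. all: by end_near. Qed.

Lemma is_derive_cRe s : derivable f (u + rC s *: v) v ->
  is_derive s 1 (fun r => cRe (f (u + rC r *: v))) (cRe ('D_v f (u + rC s *: v))).
Proof.
move=> /cvg_real_quotient dq.
have h := cvg_comp _ _ dq (@continuous_cRe _).
suff e : k^-1 *: (((fun r => cRe (f (u + rC r *: v))) \o shift s) (k *: 1) -
    cRe (f (u + rC s *: v))) @[k --> 0^'] --> cRe ('D_v f (u + rC s *: v)).
  by split; [apply/cvg_ex; eexists; exact: e|exact: cvg_lim e].
apply: cvg_trans h; apply: near_eq_cvg; near=> k.
by rewrite /= -fmorphV cReM /cRe raddfB /GRing.scale /= mulr1.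
Unshelve. all: by end_near. Qed.

Lemma is_derive_cIm s : derivable f (u + rC s *: v) v ->
  is_derive s 1 (fun r => cIm (f (u + rC r *: v))) (cIm ('D_v f (u + rC s *: v))).
Proof.
move=> /cvg_real_quotient dq.
have h := cvg_comp _ _ dq (@continuous_cIm _).
suff e : k^-1 *: (((fun r => cIm (f (u + rC r *: v))) \o shift s) (k *: 1) -
    cIm (f (u + rC s *: v))) @[k --> 0^'] --> cIm ('D_v f (u + rC s *: v)).
  by split; [apply/cvg_ex; eexists; exact: e|exact: cvg_lim e].
apply: cvg_trans h; apply: near_eq_cvg; near=> k.
by rewrite /= -fmorphV cImM /cIm raddfB /GRing.scale /= mulr1.
Unshelve. all: by end_near. Qed.

(** This links the componentwise derivative inside [abelian_integral] with the complex directional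
    derivative. *)
Lemma cderive_line s : derivable f (u + rC s *: v) v ->
  cderive (fun r => f (u + rC r *: v)) s = 'D_v f (u + rC s *: v).
Proof.
move=> df; have [_ e1] := is_derive_cRe df; have [_ e2] := is_derive_cIm df.
by rewrite /cderive [X in X +i* _]e1 [X in _ +i* X]e2 /cRe /cIm; case: ('D_v f _).
Qed.

End RealLine.


(** * First-order approximation and the derivative of the exponential *)

Lemma norm_ReIm z : `|z| <= rC (`|cRe z| + `|cIm z|).
Proof.
case: z => a b; rewrite /rC normc_def lecR /cRe /cIm /=.
rewrite -[leRHS]ger0_norm ?addr_ge0 // -sqrtr_sqr ler_wsqrtr //.
by rewrite sqrrD !real_normK ?num_real // lerD2r lerDl mulrn_wge0 ?mulr_ge0.
Qed.

Lemma derive_approx (K : numFieldType) (f : K -> K) (a d e : K) : 0 < e ->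
  is_derive a 1 f d ->
  \forall h \near 0, `|f (h + a) - f a - h * d| <= e * `|h|.
Proof.
move=> e0 [/derivable_nbhs df <-].
have /eqaddoP/(_ _ e0) := df; apply: filterS => h /=.
by rewrite -[X in `|X| <= _ -> _]/(f (h *: 1 + a) - (f a + h *: 'D_1 f a))
  [h *: 1]mulr1 opprD addrA.
Qed.

Lemma is_derive_approx (K : numFieldType) (f : K -> K) (a d : K) :
  (forall e, 0 < e -> \forall h \near 0, `|f (h + a) - f a - h * d| <= e * `|h|) ->
  is_derive a 1 f d.
Proof.
move=> hf; suff e : h^-1 *: ((f \o shift a) (h *: 1) - f a) @[h --> 0^'] --> d.
  by split; [apply/cvg_ex; eexists; exact: e|exact: cvg_lim e].
apply/cvgrPdist_le => e /hf[r r0 hr]; exists r => // h /= hh h0.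
rewrite -normrN opprB -(ler_pM2r (x := `|h|)) ?normr_gt0 // -normrM.
have := hr h hh; rewrite /GRing.scale /= mulr1; congr (`|_| <= _).
by field.
Qed.

Lemma is_derive_chain (K : numFieldType) (f h : K -> K) (t a d : K) :
  is_derive (h t) 1 f a -> is_derive t 1 h d ->
  is_derive t 1 (fun s => f (h s)) (d * a).
Proof.
move=> [/derivable1_diffP df <-] [/derivable1_diffP dh <-].
have dfh : differentiable (f \o h) t by exact: differentiable_comp.
split; first exact/derivable1_diffP.
by rewrite deriveE // diff_comp //= diff1E // derive1E -deriveE.
Qed.

Lemma cexpD (z w : C) : cexp (z + w) = cexp z * cexp w.
Proof.
case: z w => [a b] [c d]; rewrite /cexp /= expRD cosD sinD.
by apply/eqP; rewrite eq_complex /=; apply/andP; split; apply/eqP; ring.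
Qed.

Lemma cexp0 : cexp (0 : C) = 1.
Proof. by rewrite /cexp /= expR0 cos0 sin0 mul1r. Qed.

Lemma is_derive_cexp0 : is_derive (0 : C) 1 (@cexp R) 1.
Proof.
apply: is_derive_approx => e0 /gt0_rC[-> e0_gt0].
(* With p = Re h and q = Im h, the real and imaginary parts of cexp h - 1 - h add
   up to at most e * (|p| + 7 * |q|). *)
pose e := Num.min 1 (cRe e0 / 8).
have e_gt0 : 0 < e by rewrite lt_min ltr01 divr_gt0.
have e1 : e <= 1 by rewrite ge_min lexx.
have e8 : 8 * e <= cRe e0.
  have : e <= cRe e0 / 8 by rewrite ge_min lexx orbT.
  lra.
have he := derive_approx e_gt0 (is_derive_expR (0 : R)).
have hc := derive_approx e_gt0 (is_derive_cos (0 : R)).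
have hs := derive_approx e_gt0 (is_derive_sin (0 : R)).
have := @continuous_cRe (0 : C); rewrite /continuous_at [cRe 0]raddf0 => Re0.
have := @continuous_cIm (0 : C); rewrite /continuous_at [cIm 0]raddf0 => Im0.
have hp : \forall p \near (0 : R), `|p| <= e.
  by exists e => // p /=; rewrite sub0r normrN => /ltW.
have hRe : \forall h \near (0 : C), `|expR (cRe h + 0) - expR 0 - cRe h * expR 0|
  <= e * `|cRe h| /\ `|cRe h| <= e :=
  Re0 _ (@filterI _ _ (nbhs_filter (0 : R)) _ _ he hp).
have hIm : \forall h \near (0 : C), `|cos (cIm h + 0) - cos 0 - cIm h * - sin 0|
  <= e * `|cIm h| /\ `|sin (cIm h + 0) - sin 0 - cIm h * cos 0|
  <= e * `|cIm h| := Im0 _ (@filterI _ _ (nbhs_filter (0 : R)) _ _ hc hs).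
apply: (@filterS2 _ _ (nbhs_filter (0 : C)) _ _ _ _ hRe hIm) => h [].
set p := cRe h; set q := cIm h.
rewrite !addr0 expR0 cos0 sin0 oppr0 mulr0 !mulr1 !subr0 !addr0 cexp0 => h1 h2 [h3 h4].
have p0 := normr_ge0 p; have q0 := normr_ge0 q.
have ep1 : e * `|p| <= `|p| by rewrite ler_piMl.
have eq1 : e * `|q| <= `|q| by rewrite ler_piMl.
have bRe : `|expR p * cos q - 1 - p| <= e * `|p| + 2 * (e * `|q|).
  have -> : expR p * cos q - 1 - p =
    (expR p - 1 - p) * cos q + p * (cos q - 1) + (cos q - 1) by ring.
  rewrite (le_trans (ler_normD _ _)) // (le_trans (lerD (ler_normD _ _) (lexx _))) //.
  rewrite !normrM; have c1 : `|cos q| <= 1 by rewrite ler_norml cos_geN1 cos_le1.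
  have := ler_pM (normr_ge0 _) (normr_ge0 _) h1 c1.
  have := ler_pM p0 (normr_ge0 _) (le_trans h2 e1) h3.
  lra.
(* The constant 5 is 2 * 2 from the bounds 2 * e on [expR p - 1] and 2 * |q| on [sin q], plus 1 from
   [sin q - q]. *)
have bIm : `|expR p * sin q - q| <= 5 * (e * `|q|).
  have -> : expR p * sin q - q = (expR p - 1) * sin q + (sin q - q) by ring.
  rewrite (le_trans (ler_normD _ _)) // normrM.
  have ep : `|expR p - 1| <= 2 * e.
    have := ler_normD (expR p - 1 - p) p; rewrite subrK; lra.
  have sq : `|sin q| <= 2 * `|q|.
    have := ler_normD (sin q - q) q; rewrite subrK; lra.
  have := ler_pM (normr_ge0 _) (normr_ge0 _) ep sq; lra.
apply: le_trans (norm_ReIm _) _.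
have -> : cRe (cexp h - 1 - h) = expR p * cos q - 1 - p.
  by rewrite /cRe !raddfB /= mul0r subr0.
have -> : cIm (cexp h - 1 - h) = expR p * sin q - q.
  by rewrite /cIm !raddfB /= mul0r addr0 subr0.
have np := norm_cRe h; have nq := norm_cIm h; rewrite -/p -/q in np nq.
have [m m0 hm] : exists2 m, 0 <= m & `|h| = rC m.
  by rewrite normc_def; eexists; last by []; rewrite sqrtr_ge0.
rewrite hm !lecR in np nq *; rewrite -rmorphM lecR.
have := ler_wpM2l (ltW e_gt0) np; have := ler_wpM2l (ltW e_gt0) nq.
have := ler_wpM2r m0 e8; lra.
Qed.

Lemma is_derive_cexp (z : C) : is_derive z 1 (@cexp R) (cexp z).
Proof.
apply: is_derive_approx => e e0.
(* The functional equation reduces the estimate at z to the one at 0, multiplied by [cexp z]; adding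
   1 makes the divisor of e visibly positive. *)
have n0 : 0 < `|cexp z| + 1 by rewrite ltr_wpDl.
have := derive_approx (divr_gt0 e0 n0) is_derive_cexp0.
apply: filterS => h; rewrite addr0 cexp0 mulr1 cexpD => hh.
have -> : cexp h * cexp z - cexp z - h * cexp z = cexp z * (cexp h - 1 - h) by ring.
rewrite normrM (le_trans (ler_wpM2l _ hh)) // mulrA ler_wpM2r //.
by rewrite mulrCA ler_piMr ?(ltW e0) // ler_pdivrMr // mul1r lerDl.
Qed.

End ComplexCalculus.

(** * From the Abel coordinates to the flow *)

Section ShrinkingMeans.
Local Open Scope complex_scope.
Variables (R : realType) (d : R).
Hypothesis d_gt0 : 0 < d.
Local Notation mu := (@lebesgue_measure R).

Lemma integrable_rescaled (H : R -> R) (h : R) :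
  (forall r, 0 <= r <= d -> {for r, continuous H}) -> 0 <= h <= d ->
  mu.-integrable `[0, 1] (EFin \o (fun s => H (s * h))).
Proof.
move=> cH /andP[h0 hd]; apply: continuous_compact_integrable.
  exact: segment_compact.
apply: continuous_in_subspaceT => s; rewrite inE /= in_itv /= => /andP[s0 s1].
apply: continuous_comp; last first.
  by apply: cH; rewrite mulr_ge0 //= (le_trans _ hd) // ler_piMl.
by apply: cvgM; [exact: cvg_id|exact: cvg_cst].
Qed.

(** The derivative of an integral at its endpoint, rescaled to a fixed domain: for small h,
    [H (s * h)] is within e of [H 0] for all s in [0, 1] at once, and so is its mean. *)
Lemma cvg_shrinking_mean (H : R -> R) :
  (forall r, 0 <= r <= d -> {for r, continuous H}) ->
  Rintegral mu `[0, 1] (fun s => H (s * h)) @[h --> 0^'+] --> H 0.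
Proof.
move=> cH; have H0 : {for 0, continuous H} by apply: cH; rewrite lexx ltW.
apply/cvgrPdist_le => e e0.
have /cvgrPdist_le/(_ e e0)[r r0 hr] := H0.
exists (Num.min r d); first by rewrite /= lt_min r0 d_gt0.
move=> h /=; rewrite sub0r normrN => hh h0.
have [hr' hd] : h < r /\ h < d by move: hh; rewrite gtr0_norm // lt_min => /andP.
have bH s : `[0, 1]%classic s -> H 0 - e <= H (s * h) <= H 0 + e.
  rewrite /= in_itv /= => /andP[s0 s1].
  have : `|H 0 - H (s * h)| <= e.
    apply: hr; rewrite /= sub0r normrN ger0_norm ?mulr_ge0 ?(ltW h0) //.
    by rewrite (le_lt_trans _ hr') // ler_piMl // ltW.
  by rewrite ler_distlC => /andP[-> ->].
have m01 : fine (mu `[0, 1]%classic) = 1.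
  by rewrite lebesgue_measure_itv /= lte_fin ltr01 oppr0 adde0.
have iH : mu.-integrable `[0, 1] (EFin \o (fun s => H (s * h))).
  by apply: integrable_rescaled => //; rewrite !ltW.
have ic (c : R) : mu.-integrable `[0, 1] (EFin \o (fun _ : R => c)).
  apply: continuous_compact_integrable; first exact: segment_compact.
  by apply: continuous_subspaceT => ?; exact: cvg_cst.
have Ic (c : R) : Rintegral mu `[0, 1] (fun=> c) = c.
  by rewrite Rintegral_cst // m01 mulr1.
rewrite ler_distlC -[X in X <= _]Ic -[X in _ && (_ <= X)]Ic.
by apply/andP; split; apply: le_Rintegral => // s /bH /andP[].
Qed.

Local Notation C := (Cplx R).

Lemma cvg_complex (T : Type) (F : set_system T) (FF : Filter F) (z : T -> C) (l : C) :
  cRe (z x) @[x --> F] --> cRe l -> cIm (z x) @[x --> F] --> cIm l ->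
  z x @[x --> F] --> l.
Proof.
move=> hr hi.
have e (w : C) : w = rC (cRe w) + 'i%C * rC (cIm w).
  by case: w => a b; rewrite /rC /cRe /cIm; simpc.
rewrite [l]e; under eq_cvg do rewrite [z _]e.
apply: cvgD; first exact: cvg_comp hr (@continuous_rC _ _).
apply: cvgM; first exact: cvg_cst.
exact: cvg_comp hi (@continuous_rC _ _).
Qed.

Lemma cvg_shrinking_cmean (W : R -> C) :
  (forall r, 0 <= r <= d -> {for r, continuous W}) ->
  cintegral (fun s => W (s * h)) 0 1 @[h --> 0^'+] --> W 0.
Proof.
move=> cW; apply: cvg_complex.
  apply: (cvg_shrinking_mean (H := fun r => cRe (W r))) => r /cW h.
  exact: continuous_comp h (@continuous_cRe _ _).
apply: (cvg_shrinking_mean (H := fun r => cIm (W r))) => r /cW h.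
exact: continuous_comp h (@continuous_cIm _ _).
Qed.

Lemma cintegral_rescaled (W : R -> C) h :
  (forall r, 0 <= r <= d -> {for r, continuous W}) -> 0 <= h <= d ->
  cintegral (fun s => rC h * W (s * h)) 0 1 = rC h * cintegral (fun s => W (s * h)) 0 1.
Proof.
move=> cW hd; rewrite /cintegral.
under eq_Rintegral do rewrite [complex.Re _]cReM.
under [in X in _ +i* X]eq_Rintegral do rewrite [complex.Im _]cImM.
rewrite !RintegralZl //; first by rewrite /rC; simpc.
  apply: (integrable_rescaled (H := fun r => cIm (W r))) => // r /cW hr.
  exact: continuous_comp hr (@continuous_cIm _ _).
apply: (integrable_rescaled (H := fun r => cRe (W r))) => // r /cW hr.
exact: continuous_comp hr (@continuous_cRe _ _).
Qed.
End ShrinkingMeans.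

Lemma continuous_horner_num (K : numFieldType) (p : {poly K}) :
  continuous (horner p).
Proof.
move=> z; apply/differentiable_continuous/derivable1_diffP.
have [] // := is_derive_horner_family (@derivable_coefs_cst K K p z 1)
  (fun=> leqnn (size p)) (is_derive_id z 1).
Qed.

Lemma dx_over_2yZ (R : realType) (f : {poly Cplx R}) p (c d e : Cplx R) :
  dx_over_2y f p (c * d) (c * e) = c * dx_over_2y f p d e.
Proof. by rewrite /dx_over_2y; case: ifP; rewrite mulrA. Qed.

Lemma eq_cintegral (R : realType) (W Z : R -> Cplx R) :
  (forall s, 0 <= s <= 1 -> W s = Z s) -> cintegral W 0 1 = cintegral Z 0 1.
Proof.
move=> WZ; rewrite /cintegral; congr Complex; apply: eq_Rintegral => s;
  by rewrite inE /= in_itv /= => /WZ ->.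
Qed.

(** * Differentiating the Abel coordinates along u_g *)

Section AbelFlow.
Variables (R : realType) (g : nat).
Local Notation C := (Cplx R).
Local Notation V := 'rV[C]_g.
Variables (b : seq C) (U : set V) (x y : 'I_g -> V -> C).
Let f := curve_poly b.
Hypotheses (b_uniq : uniq b) (hU : open U).
Hypothesis x_hol : forall i, holomorphic_on U (x i).
Hypothesis y_hol : forall i, holomorphic_on U (y i).
Hypothesis xy_curve : forall u, U u -> forall i, on_curve f (x i u, y i u).
Hypothesis xy_abel : abel_coordinates f U x y.
Local Notation v := (e_last R g).

(** The form dx/(2y) on the velocity of the i-th point in the direction u_g; it will turn out to be
    1 / F'(x_i). *)
Definition form_along i (u : V) : C :=
  dx_over_2y f (x i u, y i u) ('D_v (x i) u) ('D_v (y i) u).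

Lemma deriv_curve_poly_neq0 a : f.[a] = 0 -> f^`().[a] != 0.
Proof.
move=> /rootP fa; have : separable_poly f by rewrite separable_prod_XsubC.
by rewrite unlock => h; exact: coprimep_root h fa.
Qed.

Lemma e_lastE (k : 'I_g) : k.+1 = g -> v = delta_mx 0 k.
Proof.
move=> kg; apply/rowP => j; rewrite !mxE eqxx /=; congr (_%:R).
by rewrite -val_eqE /= -(eqSS j k) kg.
Qed.

Lemma continuous_D_last h u : holomorphic_on U h -> U u ->
  {for u, continuous ('D_v h)}.
Proof.
move=> hh Uu; have [_ hc] := hh u Uu.
(* Without coordinates the direction is the zero vector; otherwise it is the basis vector of index g
   - 1. *)
case: (posnP g) => [g0|g0].
  have -> : v = 0 by apply/rowP => j; exfalso;
      move: (leq_ltn_trans (leq0n j) (ltn_ord j)); rewrite g0.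
  have -> : 'D_0 h = cst 0 by apply/funext => w; rewrite derive0.
  exact: cst_continuous.
have gk : (g.-1 < g)%N by rewrite prednK.
by rewrite (@e_lastE (Ordinal gk)) ?prednK //; exact: hc.
Qed.

Lemma continuous_hol h u : holomorphic_on U h -> U u -> {for u, continuous h}.
Proof.
by move=> hh Uu; have [hd _] := hh u Uu; exact: differentiable_continuous.
Qed.

Lemma derivable_hol h u w : holomorphic_on U h -> U u -> derivable h u w.
Proof. by move=> hh Uu; have [hd _] := hh u Uu; exact: diff_derivable. Qed.

Lemma curve_differential i u : U u ->
  2 * y i u * 'D_v (y i) u = f^`().[x i u] * 'D_v (x i) u.
Proof.
move=> Uu; have dx := derivableP (derivable_hol (w := v) (x_hol i) Uu).
have dy := derivableP (derivable_hol (w := v) (y_hol i) Uu).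
have [_ e1] := is_derive_mul dy dy.
have [_ e2] := is_derive_horner_family (@derivable_coefs_cst C V f u v)
  (fun=> leqnn (size f)) dx.
have vel0 : velocity (size f) (fun=> f) u v = 0.
  by apply/polyP => k; rewrite coef0 coef_poly; case: ifP => // _; exact: derive_cst.
move: e2; rewrite vel0 horner0 add0r => <-.
have -> : 2 * y i u * 'D_v (y i) u = 'D_v (fun w => y i w * y i w) u.
  by rewrite e1; ring.
apply: near_eq_derive; near=> w.
by apply: xy_curve; near: w; exact: open_nbhs_nbhs.
Unshelve. all: by end_near. Qed.

(** Both formulas also hold at branch points: there y = 0 and f' is nonzero, so 2 y D y = f'(x) D x
    forces D x = 0. *)
Lemma form_alongE i u : U u ->
  'D_v (x i) u = 2 * y i u * form_along i u /\
  'D_v (y i) u = f^`().[x i u] * form_along i u.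
Proof.
move=> Uu; have e := curve_differential i Uu; rewrite /form_along /dx_over_2y /=.
case: eqVneq => [y0|y0].
  have fx : f^`().[x i u] != 0.
    by apply: deriv_curve_poly_neq0; rewrite -(xy_curve Uu i) /= y0 expr0n.
  move: e; rewrite y0 !mulr0 !mul0r => /esym/eqP.
  by rewrite mulf_eq0 (negbTE fx) /= => /eqP ->; rewrite mulrC divfK.
have two : 2 != 0 :> C by rewrite pnatr_eq0.
have y2 := mulf_neq0 two y0.
split; first by rewrite mulrC divfK.
by rewrite mulrA -e mulrC mulKf.
Qed.

(** By continuity [D] stays nonzero near [u], so [h] agrees there with N / D. *)
Lemma continuous_quotient (N D h : V -> C) u : U u -> D u != 0 ->
  {for u, continuous N} -> {for u, continuous D} ->
  (forall w, U w -> N w = D w * h w) -> {for u, continuous h}.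
Proof.
move=> Uu D0 cN cD NDh.
have hu : N u / D u = h u by rewrite NDh // mulrC mulKf.
have q : N w / D w @[w --> u] --> h u by rewrite -hu; exact: cvgM cN (cvgV D0 cD).
apply: cvg_trans q; apply: (near_eq_cvg (FF := nbhs_filter u)).
near=> w; rewrite /= NDh; last first.
  by near: w; exact: open_nbhs_nbhs.
rewrite mulrC mulKf //; near: w.
exact: cvgr_neq0 cD D0.
Unshelve. all: by end_near. Qed.

(** Near a branch point the form is D y / f'(x), elsewhere D x / (2 y). Both relations of
    [form_alongE] hold on all of [U], so the case distinction causes no jump. *)
Lemma continuous_form_along i u : U u -> {for u, continuous (form_along i)}.
Proof.
move=> Uu.
have cx := continuous_hol (x_hol i) Uu; have cy := continuous_hol (y_hol i) Uu.
have [y0|y0] := eqVneq (y i u) 0.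
  have f0 : f^`().[x i u] != 0.
    by apply: deriv_curve_poly_neq0; rewrite -(xy_curve Uu i) /= y0 expr0n.
  have cf : {for u, continuous (fun w => f^`().[x i w])}.
    exact: continuous_comp cx (@continuous_horner_num _ f^`() _).
  apply: (continuous_quotient Uu f0 (continuous_D_last (y_hol i) Uu) cf) => w Uw.
  by have [] := form_alongE i Uw.
have y2 : 2 * y i u != 0 by rewrite mulf_neq0 // pnatr_eq0.
have c2 : {for u, continuous (fun w => 2 * y i w)} by exact: cvgM (cvg_cst _) cy.
apply: (continuous_quotient Uu y2 (continuous_D_last (x_hol i) Uu) c2) => w Uw.
by have [] := form_alongE i Uw.
Qed.

Lemma derive_dirZ h u (c : C) w : holomorphic_on U h -> U u ->
  'D_(c *: w) h u = c * 'D_w h u.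
Proof.
by move=> hh Uu; have [hd _] := hh u Uu; rewrite !deriveE // linearZ.
Qed.

Lemma continuous_line (u : V) : continuous (fun r : R => u + rC r *: v).
Proof.
move=> r; apply: cvgD; first exact: cvg_cst.
apply: cvgZr_tmp; exact: continuous_rC.
Qed.

Lemma open_line u : U u -> exists2 d : R, 0 < d &
  forall r, 0 <= r <= d -> U (u + rC r *: v).
Proof.
move=> Uu; have : \forall w \near u + rC 0 *: v, U w.
  by rewrite rmorph0 scale0r addr0; exact: open_nbhs_nbhs.
(* Half the radius keeps the closed interval inside the open ball. *)
move=> /(@continuous_line u 0)[d /= d0 hd]; exists (d / 2); first by rewrite divr_gt0.
move=> r /andP[r0 rd]; apply: hd; rewrite /= sub0r normrN ger0_norm //.
by rewrite (le_lt_trans rd) // ltr_pdivrMr // ltr_pMr // ltr1n.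
Qed.

(* Rescaling the parameter turns the integral over the segment from [u] to
   [u + h *: v] into [h] times a mean value over an interval of length [h]. *)
Lemma abelian_integral_line u h i (j : 'I_g) (d : R) :
  (forall r, 0 <= r <= d -> U (u + rC r *: v)) -> 0 <= h <= d ->
  abelian_integral f j (fun s => (x i (segment_pt u (u + rC h *: v) s),
                                  y i (segment_pt u (u + rC h *: v) s))) 0 1 =
  cintegral (fun s => rC h * (x i (u + rC (s * h) *: v) ^+ j *
                              form_along i (u + rC (s * h) *: v))) 0 1.
Proof.
move=> Ud /andP[h0 hd]; apply: eq_cintegral => s /andP[s0 s1] /=.
have sE r : segment_pt u (u + rC h *: v) r = u + rC r *: (rC h *: v).
  by rewrite /segment_pt addrAC subrr add0r.
have rE r : u + rC (r * h) *: v = u + rC r *: (rC h *: v).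
  by rewrite rmorphM scalerA.
have Us : U (u + rC s *: (rC h *: v)).
  by rewrite -rE; apply: Ud; rewrite mulr_ge0 //= (le_trans _ hd) // ler_piMl.
under [X in cderive X]funext => r do rewrite sE.
under [X in dx_over_2y _ _ _ (cderive X _)]funext => r do rewrite sE.
rewrite !cderive_line; try exact: derivable_hol Us.
rewrite sE rE !(derive_dirZ _ _ _ Us) // dx_over_2yZ.
by rewrite mulrCA.
Qed.

(** The Abel coordinates at u + h v and at u differ by h times a sum of means of the integrands;
    dividing by h and letting h decrease to 0 gives the system, whose right-hand side is the j-th
    entry of v. *)
Lemma abel_system u (j : 'I_g) : U u ->
  \sum_i x i u ^+ j * form_along i u = (j.+1 == g)%:R.
Proof.
move=> Uu; have [d d0 Ud] := open_line Uu.
have [gam [c [_ _ hu]]] := xy_abel Uu.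
pose W i r := x i (u + rC r *: v) ^+ j * form_along i (u + rC r *: v).
have cW i r : 0 <= r <= d -> {for r, continuous (W i)}.
  move=> /Ud Ur; have cl := @continuous_line u r.
  have cxf : {for u + rC r *: v, continuous (fun w => x i w ^+ j * form_along i w)}.
    have cf := continuous_form_along (i := i) Ur.
    have cx := continuous_hol (x_hol i) Ur.
    have cxj : {for u + rC r *: v, continuous (fun w => x i w ^+ j)}.
      have -> : (fun w => x i w ^+ j) = horner 'X^j \o x i.
        by apply/funext => w; rewrite /= hornerXn.
      exact: continuous_comp cx (@continuous_horner_num _ 'X^j _).
    exact: cvgM cxj cf.
  exact: continuous_comp cl cxf.
have key h : 0 <= h <= d -> u 0 j + rC h * v 0 j =
    \sum_i (c i j + rC h * cintegral (fun s => W i (s * h)) 0 1).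
  move=> hd; have -> : u 0 j + rC h * v 0 j = (u + rC h *: v) 0 j by rewrite !mxE.
  rewrite hu => [|s /andP[s0 s1]].
    apply: eq_bigr => i _; rewrite (abelian_integral_line _ _ Ud) //.
    by rewrite (cintegral_rescaled (cW i)).
  have -> : segment_pt u (u + rC h *: v) s = u + rC (s * h) *: v.
    by rewrite /segment_pt addrAC subrr add0r rmorphM scalerA.
  case/andP: hd => h0 hd; apply: Ud.
  by rewrite mulr_ge0 //= (le_trans _ hd) // ler_piMl.
have mean h : 0 < h <= d -> v 0 j = \sum_i cintegral (fun s => W i (s * h)) 0 1.
  (* At h = 0, [key] says that the constants [c i j] sum to the coordinate of u, so they drop out
     and the factor h cancels. *)
  move=> /andP[h0 hd]; have := key 0; rewrite lexx (ltW d0) => /(_ isT).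
  rewrite rmorph0 mul0r addr0 big_split /= [X in _ + X]big1 => [|i _].
    rewrite addr0 => u0; have := key h; rewrite ltW //= hd => /(_ isT).
    rewrite big_split /= -u0 -mulr_sumr => /addrI /mulfI; apply.
    by rewrite fmorph_eq0 gt_eqF.
  by rewrite mul0r.
have lim1 : \sum_i cintegral (fun s => W i (s * h)) 0 1 @[h --> 0^'+] --> \sum_i W i 0.
  apply: cvg_big => [|i _]; first by move=> p; exact: add_continuous.
  exact: cvg_shrinking_cmean d0 _ (cW i).
have lim2 : \sum_i cintegral (fun s => W i (s * h)) 0 1 @[h --> 0^'+] --> v 0 j.
  apply: cvg_near_cst; near=> h; apply/esym/mean.
  by apply/andP; split; near: h; [exact: nbhs_right_gt|exact: nbhs_right_le].
have := cvg_unique _ lim1 lim2; rewrite mxE => <-.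
by apply: eq_bigr => i _; rewrite /W rmorph0 scale0r addr0.
Unshelve. all: by end_near. Qed.

End AbelFlow.

(** * The wave equation *)

Lemma is_derive_psi_time (R : realType) (g : nat) (b1 b2 : Cplx R)
    (al1 al2 : 'rV[Cplx R]_g -> Cplx R) (t : Cplx R) (u : 'rV[Cplx R]_g) :
  is_derive t 1 (fun s => psi b1 b2 al1 al2 s u)
    ('i * (b2 - b1) * psi b1 b2 al1 al2 t u).
Proof.
(* [psi] is written with ['i%C] and the statement with the imaginary unit of the closed field;
   [complexiE] identifies them. *)
rewrite -complexiE /psi; set c := _ * (b2 - b1).
have dl : is_derive t 1 (fun s => c * s) c.
  apply: is_derive_eq (is_derive_mul (is_derive_cst c t 1) (is_derive_id t 1)) _.
  by rewrite mulr1 mul0r addr0.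
have de := is_derive_chain (is_derive_cexp (c * t)) dl.
apply: is_derive_eq (is_derive_mul de (is_derive_cst (al2 u / al1 u) t 1)) _.
by rewrite mulr0 add0r mulrA.
Qed.

(** * Second derivative of the quotient of two al functions *)

Section WaveFunction.
Variables (K : numFieldType) (V : normedModType K) (U : set V) (v : V).
Variables (al1 al2 : V -> K) (k : K).
Hypothesis hU : open U.
Hypothesis al1_neq0 : forall w, U w -> al1 w != 0.
Hypothesis al2_neq0 : forall w, U w -> al2 w != 0.
Hypothesis d1 : forall w, U w -> derivable al1 w v.
Hypothesis d2 : forall w, U w -> derivable al2 w v.
Let Psi w := k * (al2 w / al1 w).

Lemma is_derive_quotient w : U w -> is_derive w v Psi
  (k * (('D_v al2 w * al1 w - al2 w * 'D_v al1 w) / (al1 w * al1 w))).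
Proof.
move=> Uw; have a0 := al1_neq0 Uw.
have dq := is_derive_div (h := al1) a0 (derivableP (d2 Uw)) (derivableP (d1 Uw)).
apply: is_derive_eq (is_derive_mul (is_derive_cst k w v) dq) _.
by rewrite mul0r addr0 expr2.
Qed.

(** The numerator of the first derivative is a Wronskian: the products of first derivatives cancel
    when it is differentiated, leaving (c2 - c1) al1 al2. The remaining term comes from the
    denominator al1^2. *)
Lemma is_derive_quotient2 u (c1 c2 : K) : U u ->
  is_derive u v ('D_v al1) (c1 * al1 u) ->
  is_derive u v ('D_v al2) (c2 * al2 u) ->
  is_derive u v ('D_v Psi)
    ((c2 - c1 + 2 * ('D_v al1 u / al1 u) *
      ('D_v al1 u / al1 u - 'D_v al2 u / al2 u)) * Psi u).
Proof.
move=> Uu e1 e2; have a1 := al1_neq0 Uu; have a2 := al2_neq0 Uu.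
have da1 := derivableP (d1 Uu); have da2 := derivableP (d2 Uu).
have dN : is_derive u v (fun w => 'D_v al2 w * al1 w - al2 w * 'D_v al1 w)
    ((c2 - c1) * (al1 u * al2 u)).
  apply: is_derive_eq (is_deriveB (is_derive_mul e2 da1) (is_derive_mul da2 e1)) _.
  by ring.
have dq := is_derive_div (h := fun w => al1 w * al1 w) (mulf_neq0 a1 a1) dN
  (is_derive_mul da1 da1).
have dk := is_derive_mul (is_derive_cst k u v) dq.
apply: near_eq_is_derive (is_derive_eq dk _).
  near=> w; rewrite (derive_val (is_derive := is_derive_quotient _)) //.
  by near: w; exact: open_nbhs_nbhs.
by rewrite /Psi /cst mul0r addr0; field; rewrite a1.
Unshelve. all: by end_near. Qed.
End WaveFunction.

(** The constant c cancels, and the left-hand side is a multiple of i^2 + 1. Division by i appears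
    as multiplication by -i. *)
Lemma wave_identity (K : comPzRingType) (i a1 a2 c p1 p2 P : K) :
  i * i = -1 ->
  i * (i * (a2 - a1) * P) + (a2 + c - (a1 + c) + 2 * p1 * (p1 - p2)) * P
  + 2 * (p1 * - i) * ((p1 - p2) * - i) * P = 0.
Proof.
move=> i2.
transitivity ((i * i + 1) * (a2 - a1 + 2 * p1 * (p1 - p2)) * P); first by ring.
by rewrite i2 addNr !mul0r.
Qed.

Theorem corollary5p7 (R : realType) (g : nat) (hg : (0 < g)%N)
  (b : (2 * g + 1).-tuple (Cplx R)) (hb : uniq b)
  (U : set 'rV[Cplx R]_g) (hU : open U)
  (x y : 'I_g -> 'rV[Cplx R]_g -> Cplx R)
  (hx : forall i, holomorphic_on U (x i))
  (hy : forall i, holomorphic_on U (y i))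
  (hcurve : forall u, U u -> forall i, on_curve (curve_poly b) (x i u, y i u))
  (hdistinct : forall u, U u -> injective (fun i => x i u))
  (hb12 : forall u, U u -> forall i, x i u != b`_0 /\ x i u != b`_1)
  (hcoord : abel_coordinates (curve_poly b) U x y)
  (al1 al2 : 'rV[Cplx R]_g -> Cplx R)
  (hal1 : is_al U x b`_0 al1) (hal2 : is_al U x b`_1 al2) :
  forall (t : Cplx R) (u : 'rV[Cplx R]_g), U u ->
    let Psi := psi b`_0 b`_1 al1 al2 in
    let dPsi := fun w => 'D_(e_last R g) (Psi t) w in
    [/\ derivable (fun s => Psi s u) t 1,
        derivable (Psi t) u (e_last R g),
        derivable dPsi u (e_last R g) &
        'i * 'D_1 (fun s => Psi s u) t + 'D_(e_last R g) dPsi u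
        + (2 * (dphi al1 u / 'i) * ((dphi al1 u - dphi al2 u) / 'i)) * Psi t u
        = 0].
Proof.
move=> t u Uu Psi dPsi; set v := e_last R g in dPsi *.
have root_f k : (k < 2 * g + 1)%N -> (curve_poly b).[b`_k] = 0.
  move=> kg; apply/rootP; rewrite root_prod_XsubC mem_nth //.
  by rewrite size_tuple.
have f0 : (curve_poly b).[b`_0] = 0 by apply: root_f; rewrite addn1.
(* The index 1 is in range because g is positive. *)
have f1 : (curve_poly b).[b`_1] = 0 by apply: root_f; rewrite addn1 ltnS muln_gt0.
(* The Abel equations are a Vandermonde system in the values of the form; [residue_weights] solves
   it. *)
have weight w i : U w -> form_along b x y i w = (conodal (fun i => x i w) i).[x i w]^-1.
  move=> Uw; apply: (residue_weights (hdistinct _ Uw) (w := form_along b x y ^~ w)).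
  by move=> j; exact: (abel_system hb hU hx hy hcurve hcoord j Uw).
have x_flow w : U w -> forall i, is_derive w v (x i)
    (2 * y i w / (conodal (fun i => x i w) i).[x i w]).
  move=> Uw i; apply: is_derive_eq (derivableP (derivable_hol (hx i) Uw)) _.
  by have [-> _] := form_alongE hb hU hx hy hcurve i Uw; rewrite weight.
have y_flow w : U w -> forall i, is_derive w v (y i)
    ((curve_poly b)^`().[x i w] / (conodal (fun i => x i w) i).[x i w]).
  move=> Uw i; apply: is_derive_eq (derivableP (derivable_hol (hy i) Uw)) _.
  by have [_ ->] := form_alongE hb hU hx hy hcurve i Uw; rewrite weight.
have f_monic : curve_poly b \is monic by exact: monic_prod_XsubC.
have size_f : size (curve_poly b) = (2 * g).+2.
  by rewrite size_prod_XsubC size_tuple addn1.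
have x0 w : U w -> forall i, x i w != b`_0 by move=> Uw i; have [] := hb12 w Uw i.
have x1 w : U w -> forall i, x i w != b`_1 by move=> Uw i; have [] := hb12 w Uw i.
have [hol1 sq1] := hal1; have [hol2 sq2] := hal2.
have d1 w : U w -> derivable al1 w v by exact: derivable_hol.
have d2 w : U w -> derivable al2 w v by exact: derivable_hol.
have [c hc] := al_second_derivative hg hU f_monic size_f hdistinct
  hcurve x_flow y_flow Uu.
have e1 := hc _ _ f0 x0 d1 sq1; have e2 := hc _ _ f1 x1 d2 sq2.
have n1 w : U w -> al1 w != 0 by exact: (al_neq0 x0 sq1).
have n2 w : U w -> al2 w != 0 by exact: (al_neq0 x1 sq2).
have dt := is_derive_psi_time b`_0 b`_1 al1 al2 t u.
(* For fixed t the exponential is a constant factor of the quotient. *)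
pose k := cexp ('i%C * (b`_1 - b`_0) * t).
have du := is_derive_quotient k n1 d1 d2 Uu.
have duu := is_derive_quotient2 k hU n1 n2 d1 d2 Uu e1 e2.
split; [by case: dt|by case: du|by case: duu|].
rewrite (derive_val (is_derive := dt)) [X in _ + X + _](derive_val (is_derive := duu)).
have i2 : 'i * 'i = -1 :> Cplx R by rewrite -expr2 sqrCi.
rewrite !invCi; exact: wave_identity i2.
Qed.
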